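(* Let $X$ be a random walk on $E$ with law $v$, and let $r\in(0,\infty)$. Assume that $X$ has a unique (up to a positive factor) $r$-invariant measure $\pi_0$ that is absolutely continuous with respect to $\pi$ and takes finite values on compact subsets of $E$ (that is, such a measure exists, and any two $r$-invariant measures for $X$ with these two properties differ by a positive factor). Then: (a) there exists a unique continuous exponential $\varphi$ on $E$ satisfying $$r=\Bigl[\int_E\varphi\,dv\Bigr]^{-1};$$ (b) the function $\psi=\varphi^{-1}=1/\varphi$ is the unique continuous exponential on $E$ satisfying $$r=\Bigl[\int_E\psi\,d\hat v\Bigr]^{-1};$$ (c) $\varphi$ is an $r$-invariant function for $X$, and $\psi$ is an $r$-invariant function for the dual random walk $\hat X$; (d) the measure $\pi_0$ coincides with $\psi\pi$ up to a positive factor.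
   Context: $E$ is a locally compact group with countable base, written multiplicatively, with Borel $\sigma$-algebra $\mathcal{E}$; $\pi$ is a fixed right Haar measure on $\mathcal{E}$. A random walk $X=(X_n)_{n\ge0}$ on $E$ with law $v$ (a Borel probability measure on $E$) is the Markov chain with one-step transition probabilities $p(x,A)=v(x^{-1}A)$ and transition operator $Pf(x)=\int f(xy)\,v(dy)$. The dual random walk $\hat X$ is the random walk with law $\hat v(A)=v(A^{-1})$, $A^{-1}=\{x: x^{-1}\in A\}$, and transition operator $\hat Pf(x)=\int f(xy)\,\hat v(dy)$. For a measure $\nu$ on $\mathcal{E}$, $\nu P(A)=\int p(x,A)\,\nu(dx)$; for a nonnegative Borel function $f$, $f\nu$ denotes the measure $A\mapsto\int_A f\,d\nu$. An exponential on $E$ is a Borel function $\varphi:E\to(0,\infty)$ with $\varphi(xy)=\varphi(x)\varphi(y)$ for all $x,y\in E$. For $r\in(0,\infty)$, a Borel function $f:E\to[0,\infty]$ is $r$-invariant for $X$ if $\int f\,d\pi>0$, $f\not\equiv\infty$ and $f=rPf$ (everywhere on $E$); a measure $\nu$ on $\mathcal{E}$ is $r$-invariant for $X$ if $\nu(E)>0$ and $\nu=r\,\nu P$. For $\hat X$ the definitions are the same with $\hat P$ in place of $P$. *)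

(* Defs.v *)
From HB Require Import structures.
From mathcomp Require Import all_boot all_order all_algebra.
From mathcomp Require Import all_classical all_reals all_analysis.
From mathcomp Require Import measurable_realfun.
Set Implicit Arguments.
Unset Strict Implicit.
Unset Printing Implicit Defensive.
Import Order.TTheory GRing.Theory Num.Theory.
Import numFieldNormedType.Exports.
Local Open Scope classical_set_scope.
Local Open Scope ring_scope.
Local Open Scope ereal_scope.

(* The library has additive topological groups only.  The distinguished point
   inherited from [PointedTopological] is unconstrained and plays no role: it
   is there because measurable types are pointed. *)
HB.mixin Record isTopologicalGroup G of PointedTopological G & Group G := {
  mulg_continuous : continuous (fun p : G * G => (p.1 * p.2)%g) ;
  invg_continuous : continuous (fun x : G => x^-1%g)
}.

#[short(type="topGroupType")]
HB.structure Definition TopologicalGroup :=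
  {G of PointedTopological G & Group G & isTopologicalGroup G}.

(* "Locally compact group with countable base"; as usual, topological groups
   are understood to be Hausdorff. *)
Definition lccb_group (E : topGroupType) : Prop :=
  [/\ hausdorff_space E, locally_compact [set: E] & @second_countable E].

Notation borel E := (g_sigma_algebraType (@open E)).

Section random_walk.
Context (R : realType) (E : topGroupType).
Implicit Types (v : probability (borel E) R) (phi : E -> R).
Implicit Types (pi nu : {measure set (borel E) -> \bar R}).

Definition inverse (x : borel E) : borel E := (x : E)^-1%g.

Lemma measurable_inverse : measurable_fun [set: borel E] inverse.
Proof.
apply: (@measurability _ _ (borel E) (borel E) setT inverse (@open E)) => [|_ [B oB <-]]; first by [].
rewrite setTI; apply: sub_sigma_algebra.
by apply: open_comp => [x _|]; [exact: invg_continuous|exact: oB].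
Qed.

HB.instance Definition _ :=
  isMeasurableFun.Build _ _ (borel E) (borel E) inverse measurable_inverse.

Definition dual_law v : probability (borel E) R := distribution v inverse.

Definition finite_on_compacts nu : Prop :=
  forall K : set E, compact K -> nu K < +oo.

Definition right_Haar pi : Prop :=
  [/\ 0 < pi setT, finite_on_compacts pi &
      forall (x : E) (A : set E), (@open E).-sigma.-measurable A ->
        pi [set (a * x)%g | a in A] = pi A].

(* A random walk enters only through its transition probabilities, hence
   through its law [v]. *)
Definition step v (x : E) (A : set E) : \bar R :=
  v [set (x^-1 * a)%g | a in A].

Definition transition_op v (f : E -> \bar R) (x : E) : \bar R :=
  \int[v]_y f (x * (y : E))%g.

Definition measure_step v nu (A : set E) : \bar R :=
  \int[nu]_x step v x A.

Definition invariant_fun pi v (r : R) (f : E -> \bar R) : Prop :=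
  [/\ measurable_fun [set: borel E] (f : borel E -> \bar R),
      (forall x, 0 <= f x),
      0 < \int[pi]_x f x,
      (exists x, f x != +oo) &
      (forall x, f x = r%:E * transition_op v f x)].

Definition invariant_measure v (r : R) nu : Prop :=
  0 < nu setT /\
  forall A : set E, (@open E).-sigma.-measurable A ->
    nu A = r%:E * measure_step v nu A.

Definition exponential phi : Prop :=
  [/\ measurable_fun [set: borel E] (phi : borel E -> R),
      (forall x, (0 < phi x)%R) &
      (forall x y, phi (x * y)%g = (phi x * phi y)%R)].

(* If the integral is infinite then its inverse is [0] and the last condition
   fails for [0 < r]. *)
Definition continuous_exponential_for v (r : R) phi : Prop :=
  [/\ exponential phi, continuous phi &
      r%:E = (\int[v]_x (phi x)%:E)^-1].

Definition density (f : E -> R) nu (A : set E) : \bar R :=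
  \int[nu]_(x in (A : set (borel E))) (f x)%:E.

Definition proportional (mu nu : set (borel E) -> \bar R) : Prop :=
  exists2 c : R, (0 < c)%R &
    forall A : set E, (@open E).-sigma.-measurable A -> mu A = c%:E * nu A.

Definition ac_radon_invariant_measure pi v (r : R) nu : Prop :=
  [/\ invariant_measure v r nu, nu `<< pi & finite_on_compacts nu].

End random_walk.

(* Main.v *)
From HB Require Import structures.
Require Import Defs.
From mathcomp Require Import all_boot all_order all_algebra.
From mathcomp Require Import all_classical all_reals all_analysis.
From mathcomp Require Import measurable_realfun lra.
Import Order.TTheory GRing.Theory Num.Theory.
Import numFieldNormedType.Exports.
Local Open Scope classical_set_scope.
Local Open Scope ring_scope.

(** Left translations commute with the walk.  Hence, for each [g], the measure
    [A |-> pi0 (gA)] is again [r]-invariant and finite on compact sets; it is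
    absolutely continuous because left translations preserve the null sets of
    a right Haar measure.  The uniqueness hypothesis gives
    [pi0 (gA) = c0(g) pi0 A], where [c0] is multiplicative and, since [pi0] is
    finite on compact sets, continuous ([left_scaling_exponential]).  In the
    same way [pi (gA) = c(g) pi A], this time by uniqueness of Haar measure
    ([right_Haar_quasi_invariant]).

    A nonzero measure finite on compact sets is determined up to a factor by
    the homomorphism by which left translations scale it
    ([left_scaling_unique]).  The measure [(c0/c) pi] is scaled by [c0], like
    [pi0]; so [pi0] is proportional to [psi pi] with [psi = c0/c], and
    [phi = 1/psi] is the exponential to be found.

    The link between exponentials and invariance is on the other side.  Since
    [pi] is right invariant, [phi^-1 pi] satisfies
    [(phi^-1 pi) (A y^-1) = phi(y) (phi^-1 pi) A]; by Tonelli, one step of the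
    walk multiplies any measure with this property by the number [\int phi dv]
    ([right_scaling_step]).  So [phi^-1 pi] is [r]-invariant exactly when
    [r \int phi dv = 1].  For the [phi] above, invariance of [pi0] gives this
    equality.  Conversely a continuous exponential [phi'] with
    [r \int phi' dv = 1] yields an invariant measure [phi'^-1 pi], which is
    proportional to [pi0], and proportional measures are scaled by the same
    function: [phi' = phi].  The claims on the dual walk follow because
    [phi^-1] integrates against the dual law as [phi] does against [v].

    The lemma [left_scaling_unique], whose case [c = 1] is the uniqueness of
    Haar measure used above, rests on one computation with Tonelli's theorem,
    [haar_product_identity]. *)

Set Implicit Arguments.
Unset Strict Implicit.
Unset Printing Implicit Defensive.

(** * Topology of a second countable locally compact group *)

Section topology.
Context (E : topGroupType).

Lemma continuous_lmul (g : E) : continuous (fun x : E => (g * x)%g).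
Proof.
move=> x; apply: (@continuous2_cvg _ _ _ _ _ _ _ _ (fun a b : E => (a * b)%g)).
- exact: (@mulg_continuous E (g, x)).
- exact: cvg_cst.
- exact: cvg_id.
Qed.

Lemma continuous_rmul (g : E) : continuous (fun x : E => (x * g)%g).
Proof.
move=> x; apply: (@continuous2_cvg _ _ _ _ _ _ _ _ (fun a b : E => (a * b)%g)).
- exact: (@mulg_continuous E (x, g)).
- exact: cvg_id.
- exact: cvg_cst.
Qed.

(** The [n]-th set is the union of the at most one basic set of code [n], hence
    empty when [n] codes none. *)
Lemma second_countable_seq : @second_countable E ->
  exists2 b : nat -> set E, (forall n, open (b n)) &
    forall (x : E) U, nbhs x U -> exists2 n, b n x & b n `<=` U.
Proof.
move=> [B /countable_injP[f injf] [oB bB]].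
exists (fun n => \bigcup_(A in B `&` [set A | f A = n]) A).
  by move=> n; apply: bigcup_open => A [/oB].
move=> x U /bB[A [BA Ax] AU]; exists (f A); first by exists A.
move=> y [A' [BA' /injf]]; rewrite !inE => /(_ BA' BA) ->; exact: AU.
Qed.

(** This Lindelof property is applied to two choices of [P]: being contained in
    a compact set, for sigma-finiteness, and being contained in a null open set,
    for the fact that a locally null measure vanishes. *)
Lemma countable_open_cover (P : set E -> Prop) : @second_countable E ->
  (forall A B, A `<=` B -> P B -> P A) ->
  (forall x : E, exists2 U, nbhs x U & P U) ->
  exists2 F : nat -> set E, (forall n, open (F n) /\ P (F n)) &
    \bigcup_n F n = setT.
Proof.
move=> /second_countable_seq[b ob bE] PS Px.
exists (fun n => [set x | P (b n) /\ b n x]).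
  move=> n; have [Pn|nPn] := pselect (P (b n)).
    have -> : [set x | P (b n) /\ b n x] = b n by apply/seteqP; split => x//= [].
    by split.
  have -> : [set x | P (b n) /\ b n x] = set0 by apply/seteqP; split => x//= [].
  split; first exact: open0.
  have [U _ PU] := Px 1%g; apply: PS PU => x []//.
apply/seteqP; split => // x _; have [U xU PU] := Px x.
by have [n bnx bnU] := bE _ _ xU; exists n => //; split=> //; exact: PS PU.
Qed.

Lemma locally_compact_nbhs (x : E) : locally_compact [set: E] ->
  exists2 K, compact K & nbhs x K.
Proof.
move=> /(_ x I) [K xK [cK _]]; exists K => //.
exact: (@filterS _ (nbhs x) _ [set y | setT y -> K y] K (fun y h => h I) xK).
Qed.

Lemma compact_mul (A B : set E) : compact A -> compact B ->
  compact [set (p.1 * p.2)%g | p in A `*` B].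
Proof.
move=> cA cB; apply: continuous_compact; last exact: compact_setX.
by apply: continuous_subspaceT => p; exact: mulg_continuous.
Qed.

(** The preimage is the image under the inverse homeomorphism. *)
Lemma compact_preimage_can (f f' : E -> E) (K : set E) :
  cancel f f' -> cancel f' f -> continuous f' -> compact K ->
  compact (f @^-1` K).
Proof.
move=> fK f'K cf' cK; rewrite (_ : f @^-1` K = f' @` K).
  by apply: continuous_compact => //; exact: continuous_subspaceT.
apply/seteqP; split=> [x Kx|x [y Ky <-]]; last by rewrite /preimage/= f'K.
by exists (f x).
Qed.

(** Nesting makes continuity from above of a measure applicable; prescribing the
    first set makes it possible to keep all of them relatively compact. *)
Lemma nested_nbhs_base (U : set E) (x : E) : @second_countable E ->
  open U -> U x ->
  exists V : nat -> set E, [/\ forall n, open (V n), forall n, V n x,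
    forall n, V n.+1 `<=` V n, V 0%N = U &
    forall W, nbhs x W -> exists n, V n `<=` W].
Proof.
move=> /second_countable_seq[b ob bE] oU Ux.
pose B i := [set y | b i x -> b i y].
have oB i : open (B i).
  have [bix|nbix] := pselect (b i x).
    rewrite (_ : B i = b i)//; apply/seteqP; split=> y; first exact.
    by move=> biy _.
  rewrite (_ : B i = setT); first exact: openT.
  by apply/seteqP; split => // y _ /nbix.
pose V := fix V n := if n is m.+1 then V m `&` B m else U.
exists V; split => //.
- by elim=> [//|n IH]; exact: openI.
- by elim=> [//|n IH]; split.
- by move=> n y [].
move=> W /bE[n bnx bnW]; exists n.+1 => y [_ Bny].
by apply: bnW; exact: Bny.
Qed.

Lemma continuous_invg_mul (h : E) : continuous (fun y : E => (y^-1 * h)%g).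
Proof.
move=> y; apply: (@continuous_comp _ _ _ (fun y => y^-1)%g (fun y => y * h)%g).
  exact: invg_continuous.
exact: continuous_rmul.
Qed.

Lemma compact_preimage_invg_mul (h : E) (K : set E) : compact K ->
  compact ((fun y : E => (y^-1 * h)%g) @^-1` K).
Proof.
apply: (@compact_preimage_can _ (fun y : E => (h * y^-1)%g)).
- by move=> y; rewrite invgM invgK mulVKg.
- by move=> y; rewrite invgM invgK mulgVK.
- move=> y; apply: (@continuous_comp _ _ _ (fun y => y^-1)%g (fun y => h * y)%g).
    exact: invg_continuous.
  exact: continuous_lmul.
Qed.

End topology.

(** * Borel measurability *)

Section measurability.
Context (R : realType) (E : topGroupType).

Lemma open_borel (A : set E) : open A -> measurable (A : set (borel E)).
Proof. exact: sub_sigma_algebra. Qed.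

Lemma closed_borel (A : set E) : closed A -> measurable (A : set (borel E)).
Proof.
move=> cA; rewrite -[A]setCK; apply: measurableC; apply: open_borel.
exact: closed_openC.
Qed.

Lemma continuous_borel (f : E -> E) : continuous f ->
  measurable_fun setT (f : borel E -> borel E).
Proof.
move=> cf; apply: (@measurability _ _ (borel E) (borel E) setT f (@open E)) => //.
move=> _ [B oB <-]; rewrite setTI; apply: open_borel.
by apply: open_comp => [x _|]; [exact: cf|exact: oB].
Qed.

Lemma continuous_borel_real (f : E -> R) : continuous f ->
  measurable_fun setT (f : borel E -> R).
Proof.
move=> cf; apply: (measurability _ (RGenOpens.measurableE R)) => _ [_ [a [b ->]] <-].
rewrite setTI; apply: open_borel; apply: open_comp => [x _|]; first exact: cf.
exact: interval_open.
Qed.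

Lemma measurable_fun_inv_gt0 d (T : measurableType d) (f : T -> R) :
  (forall x, 0 < f x) -> measurable_fun setT f ->
  measurable_fun setT (fun x => (f x)^-1).
Proof.
move=> f_gt0 mf; rewrite (_ : (fun _ => _) = (fun x => f x `^ (-1))).
  exact: (measurableT_comp (measurable_powR (-1)%R) mf).
by apply/funext => x; rewrite powR_inv1// ltW.
Qed.

(** The open preimage of an open set is a union of boxes.  Second countability
    makes this union countable, so that it lies in the product sigma-algebra and
    not only in the Borel sigma-algebra of the product space. *)
Lemma measurable_mulg : @second_countable E ->
  measurable_fun setT (fun p : borel E * borel E => (p.1 * p.2)%g : borel E).
Proof.
move=> /second_countable_seq[b ob bE].
apply: (@measurability _ _ _ (borel E) setT _ (@open E)) => // _ [B oB <-].
rewrite setTI.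
have -> : (fun p : E * E => (p.1 * p.2)%g) @^-1` B =
  \bigcup_i \bigcup_j [set p | b i `*` b j `<=` (fun p => (p.1 * p.2)%g) @^-1` B
                               /\ (b i `*` b j) p].
  apply/seteqP; split=> [[x y] Bxy|p [i _ [j _ [+ ijp]]]]; last exact.
  have : nbhs (x, y) ((fun p : E * E => (p.1 * p.2)%g) @^-1` B).
    by apply: mulg_continuous; exact: open_nbhs_nbhs.
  move=> [[U V] [/= /bE[i bix biU] /bE[j bjy bjV]] UV].
  exists i => //; exists j => //; split=> //= -[x' y'] [/= bx' by'].
  exact: (UV (x', y') (conj (biU _ bx') (bjV _ by'))).
apply: bigcupT_measurable => i; apply: bigcupT_measurable => j.
have [h|nh] := pselect (b i `*` b j `<=` (fun p => (p.1 * p.2)%g) @^-1` B).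
  rewrite (_ : [set p | _ /\ _] = b i `*` b j); last first.
    by apply/seteqP; split => p//= -[].
  by apply: measurableX; exact: open_borel.
rewrite (_ : [set p | _ /\ _] = set0); first exact: measurable0.
by apply/seteqP; split => p//= -[].
Qed.

Lemma measurable_lmul (g : E) :
  measurable_fun setT ((fun x : E => (g * x)%g) : borel E -> borel E).
Proof. by apply: continuous_borel; exact: continuous_lmul. Qed.

Lemma measurable_rmul (g : E) :
  measurable_fun setT ((fun x : E => (x * g)%g) : borel E -> borel E).
Proof. by apply: continuous_borel; exact: continuous_rmul. Qed.

Lemma measurable_fun_mulg d (T : measurableType d) (a b : T -> borel E) :
  @second_countable E ->
  measurable_fun setT a -> measurable_fun setT b ->
  measurable_fun setT (fun t => (a t * b t)%g : borel E).
Proof.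
move=> scE ma mb.
exact: (measurableT_comp (measurable_mulg scE) (measurable_fun_pair ma mb)).
Qed.

Lemma measurable_fun_invg d (T : measurableType d) (a : T -> borel E) :
  measurable_fun setT a -> measurable_fun setT (fun t => (a t)^-1%g : borel E).
Proof. by move=> ma; exact: (measurableT_comp (@measurable_inverse E)). Qed.

End measurability.

(** * Measures that are finite on compact sets *)

Section radon_measures.
Local Open Scope ereal_scope.
Context (R : realType) (E : topGroupType) (lccbE : lccb_group E).
Implicit Types pi mu nu : {measure set (borel E) -> \bar R}.

(** In a locally compact second countable space, finiteness on compact sets
    already implies regularity, whence the name. *)
Definition nonzero_radon mu := 0 < mu setT /\ finite_on_compacts mu.

Lemma compact_borel (K : set E) : compact K -> measurable (K : set (borel E)).
Proof.
case: lccbE => hE _ _ cK; apply: closed_borel; exact: compact_closed.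
Qed.

Lemma sigma_finite_radon mu : finite_on_compacts mu -> sigma_finite setT mu.
Proof.
case: lccbE => _ lcE scE fmu.
have [A B AB [K cK BK]|x|F oF FT] :=
  @countable_open_cover E (fun U => exists2 K, compact K & U `<=` K) scE.
- by exists K => //; exact: subset_trans BK.
- by have [K cK xK] := locally_compact_nbhs x lcE; exists K => //; exists K.
exists F => // n; have [oFn [K cK FnK]] := oF n.
split; first exact: open_borel.
apply: le_lt_trans (fmu _ cK); apply: le_measure => //; rewrite inE.
  exact: open_borel.
exact: compact_borel.
Qed.

Lemma measure_setT_eq0 mu :
  (forall x : E, exists U, [/\ open U, U x & mu U = 0]) -> mu setT = 0.
Proof.
case: lccbE => _ lcE scE mu0.
have [A B AB [U [oU BU U0]]|x|F oF <-] := @countable_open_cover E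
    (fun A => exists U, [/\ open U, A `<=` U & mu U = 0]) scE.
- by exists U; split => //; exact: subset_trans BU.
- have [U [oU Ux U0]] := mu0 x; exists U; first exact: open_nbhs_nbhs.
  by exists U; split.
apply: (measure_negligible (mu := mu)).
  by apply: bigcupT_measurable => n; apply: open_borel; exact: (oF n).1.
apply: negligible_bigcup => n; have [_ [U [oU FU U0]]] := oF n.
by exists U; split => //; exact: open_borel.
Qed.

Lemma exists_compact_gt0 mu : 0 < mu setT ->
  exists2 K : set E, compact K & 0 < mu K.
Proof.
move=> mu_gt0; apply/not_exists2P => nK.
move: mu_gt0; rewrite (_ : mu setT = 0) ?ltxx//; apply: measure_setT_eq0 => x.
case: lccbE => _ lcE _; have [K cK] := locally_compact_nbhs x lcE.
rewrite nbhsE => -[U [oU Ux] UK]; exists U; split => //.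
have [//|/negP] := nK K; rewrite lt_neqAle measure_ge0 andbT negbK => /eqP K0.
apply/eqP; rewrite eq_le measure_ge0 andbT K0.
apply: le_measure => //; rewrite inE; first exact: open_borel.
exact: compact_borel.
Qed.

(** Repackages a measure so that theorems on product measures apply to it. *)
Lemma radon_sigma_finite_measure mu : finite_on_compacts mu ->
  exists mu' : {sigma_finite_measure set (borel E) -> \bar R}, mu = mu'.
Proof.
move=> /sigma_finite_radon smu.
pose H1 := isSFinite.Build _ _ _ mu (sfinite_measure_sigma_finite smu).
pose H2 := isSigmaFinite.Build _ _ _ mu smu.
pose mu' := HB.pack_for {sigma_finite_measure set (borel E) -> \bar R}
  (Measure.sort mu) H1 H2.
by exists mu'; exact: eq_measure.
Qed.

Lemma fubini_radon mu nu (f : borel E * borel E -> \bar R) :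
  finite_on_compacts mu -> finite_on_compacts nu ->
  measurable_fun setT f -> (forall p, 0 <= f p) ->
  \int[mu]_x \int[nu]_y f (x, y) = \int[nu]_y \int[mu]_x f (x, y).
Proof.
move=> /radon_sigma_finite_measure[mu' ->] /radon_sigma_finite_measure[nu' ->].
exact: fubini_tonelli.
Qed.

Lemma measurable_integral_radon nu (f : borel E * borel E -> \bar R) :
  finite_on_compacts nu -> measurable_fun setT f -> (forall p, 0 <= f p) ->
  measurable_fun setT (fun x => \int[nu]_y f (x, y)).
Proof.
move=> /radon_sigma_finite_measure[nu' ->].
exact: measurable_fun_fubini_tonelli_F.
Qed.

Lemma pushforward_measure mu (T : borel E -> borel E) : measurable_fun setT T ->
  exists nu, (forall A, nu A = mu (T @^-1` A)) /\
    (forall f, measurable_fun setT f -> (forall x, 0 <= f x) ->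
       \int[nu]_x f x = \int[mu]_x f (T x)).
Proof.
move=> mT.
pose nu : {measure set (borel E) -> \bar R} :=
  measure_function_pushforward__canonical__measure_function_Measure mu mT.
exists nu; split=> // f mf f0.
by rewrite (@ge0_integral_pushforward _ _ _ _ _ T mT mu setT f).
Qed.

Lemma density_measure mu (f : E -> R) :
  measurable_fun setT (f : borel E -> R) -> (forall x, 0 <= f x)%R ->
  exists nu, forall A, nu A = density f mu A.
Proof.
move=> mf f0.
have mu0 : density f mu set0 = 0 by rewrite /density integral_set0.
have muge0 (A : set (borel E)) : 0 <= density f mu A.
  by apply: integral_ge0 => x _; rewrite lee_fin.
have mus : semi_sigma_additive (density f mu : set (borel E) -> \bar R).
  by apply: semi_sigma_additive_nng_induced => //; exact/measurable_EFinP.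
pose nu : {measure set (borel E) -> \bar R} :=
  HB.pack (density f mu : set (borel E) -> \bar R)
    (isMeasure.Build _ (borel E) R (density f mu) mu0 muge0 mus).
by exists nu.
Qed.

Lemma integral_comp_scaling mu (T : borel E -> borel E) (k : R)
    (f : borel E -> \bar R) :
  measurable_fun setT T -> (0 <= k)%R ->
  (forall A : set (borel E), measurable A -> mu (T @^-1` A) = k%:E * mu A) ->
  measurable_fun setT f -> (forall x, 0 <= f x) ->
  \int[mu]_x f (T x) = k%:E * \int[mu]_x f x.
Proof.
move=> mT k0 muT mf f0.
rewrite -(@ge0_integral_mscale _ _ _ mu _ measurableT (NngNum k0))//.
rewrite -(@ge0_integral_pushforward _ _ _ _ _ T mT mu setT f)//.
by apply: eq_measure_integral => A mA _; rewrite /mscale/= /pushforward muT.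
Qed.

End radon_measures.

(** * Relatively invariant measures and uniqueness of Haar measure *)

Section relative_invariance.
Local Open Scope ereal_scope.
Context (R : realType) (E : topGroupType) (lccbE : lccb_group E).
Implicit Types pi mu nu : {measure set (borel E) -> \bar R}.

(** Relative invariance with multiplier [c]: the preimage of [A] under
    [x |-> g^-1 x] is the translate [gA]. *)
Definition left_scaling (c : E -> R) mu :=
  forall (g : E) (A : set (borel E)), measurable A ->
    mu ((fun x : E => (g^-1 * x)%g) @^-1` A) = (c g)%:E * mu A.

Lemma right_Haar_preimage pi : right_Haar pi ->
  forall (g : E) (A : set (borel E)), measurable A ->
    pi ((fun x : E => (x * g)%g) @^-1` A) = pi A.
Proof.
move=> [_ _ inv] g A mA; rewrite -[RHS](inv g^-1%g)//; congr (pi _).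
apply/seteqP; split=> [x Ax|_ [x Ax <-]]; last by rewrite /preimage/= mulgVK.
by exists (x * g)%g => //; rewrite mulgK.
Qed.

Lemma right_Haar_integral pi : right_Haar pi ->
  forall (g : E) (f : borel E -> \bar R), measurable_fun setT f ->
  (forall x, 0 <= f x) -> \int[pi]_x f ((x : E) * g)%g = \int[pi]_x f x.
Proof.
move=> Hpi g f mf f0.
rewrite (@integral_comp_scaling _ _ pi (fun x : E => (x * g)%g) 1)//.
- by rewrite mul1e.
- exact: measurable_rmul.
- by move=> A mA; rewrite mul1e right_Haar_preimage.
Qed.

(** If an open set [U] containing [u] were null, then so would be its right
    translates, and [U u^-1 x] is an open neighbourhood of [x]. *)
Lemma right_Haar_open_gt0 pi (U : set E) : right_Haar pi -> open U ->
  U !=set0 -> 0 < pi U.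
Proof.
move=> Hpi oU [u Uu]; rewrite lt_neqAle measure_ge0 andbT eq_sym.
have [pi_gt0 _ _] := Hpi.
apply: contraTN pi_gt0 => /eqP U0; rewrite (measure_setT_eq0 lccbE) ?ltxx// => x.
exists ((fun y => y * (x^-1 * u))%g @^-1` U); split.
- by apply: open_comp => // y _; exact: continuous_rmul.
- by rewrite /preimage/= mulVKg.
- by rewrite right_Haar_preimage//; exact: open_borel.
Qed.

Lemma left_scaling_integral mu (c : E -> R) : (forall g, 0 < c g)%R ->
  left_scaling c mu ->
  forall (g : E) (f : borel E -> \bar R), measurable_fun setT f ->
  (forall x, 0 <= f x) ->
  \int[mu]_x f (g^-1 * (x : E))%g = (c g)%:E * \int[mu]_x f x.
Proof.
move=> c_gt0 muc g f mf f0.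
rewrite (@integral_comp_scaling _ _ mu (fun x : E => (g^-1 * x)%g) (c g))//.
- exact: measurable_lmul.
- exact: ltW.
- by move=> A mA; rewrite muc.
Qed.

(** The density of [pi] with respect to a relatively invariant measure.  By right
    invariance of [pi] the left-hand side is the double integral of
    [f(yx) h(x)]; exchanging the integrals and substituting [y^-1 x] for [x] in
    the integral over [mu], at the cost of the factor [1/c(y)], frees [f] from
    the variable [y].  So, up to the constant [\int h dmu], the measure [pi] has
    with respect to [mu] the density given by the inner integral on the right,
    which depends on [mu] only through [c]. *)
Lemma haar_product_identity pi mu (c : E -> R) (f h : borel E -> \bar R) :
  right_Haar pi -> finite_on_compacts mu -> left_scaling c mu ->
  measurable_fun setT (c : borel E -> R) -> (forall g, 0 < c g)%R ->
  measurable_fun setT f -> (forall x, 0 <= f x) ->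
  measurable_fun setT h -> (forall x, 0 <= h x) ->
  (\int[pi]_x f x) * (\int[mu]_x h x) =
  \int[mu]_x (f x * \int[pi]_y ((c y)^-1%:E * h ((y : E)^-1 * x)%g)).
Proof.
move=> Hpi mufin muc mc c_gt0 mf f0 mh h0; have [_ pifin _] := Hpi.
have [_ _ scE] := lccbE.
have mcV : measurable_fun setT (fun y : borel E => (c y)^-1%:E).
  by apply/measurable_EFinP; exact: measurable_fun_inv_gt0.
have mulmf : measurable_fun setT (fun p : borel E * borel E => f (p.2 * p.1)%g).
  by apply: (measurableT_comp mf); apply: measurable_fun_mulg.
have mdivh : measurable_fun setT (fun p : borel E * borel E => h (p.2^-1 * p.1)%g).
  apply: (measurableT_comp mh); apply: measurable_fun_mulg => //.
  exact: measurable_fun_invg.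
rewrite -ge0_integralZl//; last exact: integral_ge0.
(* right invariance of [pi] *)
transitivity (\int[mu]_x \int[pi]_y (f ((y : E) * x)%g * h x)).
  apply: eq_integral => x _; rewrite ge0_integralZr//; last first.
    by apply: (measurableT_comp mf); exact: measurable_rmul.
  by rewrite right_Haar_integral.
rewrite (@fubini_radon _ _ lccbE mu pi
    (fun p => f ((p.2 : E) * p.1)%g * h p.1))//; last 2 first.
- by apply: emeasurable_funM => //; exact: (measurableT_comp mh).
- by move=> p; exact: mule_ge0.
(* relative invariance of [mu] under left translation by [y] *)
transitivity (\int[pi]_y \int[mu]_x (f x * ((c y)^-1%:E * h ((y : E)^-1 * x)%g))).
  apply: eq_integral => y _ /=.
  have mhy : measurable_fun setT (fun x : borel E => h ((y : E)^-1 * x)%g).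
    by apply: (measurableT_comp mh); exact: measurable_lmul.
  have -> : (fun x : borel E => f x * ((c y)^-1%:E * h ((y : E)^-1 * x)%g)) =
      (fun x => (c y)^-1%:E * (f x * h ((y : E)^-1 * x)%g)).
    by apply/funext => x; rewrite muleCA.
  rewrite ge0_integralZl//; last 3 first.
  - by apply: emeasurable_funM.
  - by move=> x _; exact: mule_ge0.
  - by rewrite lee_fin invr_ge0 ltW.
  have mG : measurable_fun setT (fun x : borel E => f ((y : E) * x)%g * h x).
    by apply: emeasurable_funM => //; apply: (measurableT_comp mf); exact: measurable_lmul.
  have -> : \int[mu]_x (f x * h ((y : E)^-1 * x)%g) =
      (c y)%:E * \int[mu]_x (f ((y : E) * x)%g * h x).
    rewrite -(left_scaling_integral c_gt0 muc)//.
      by apply: eq_integral => x _; rewrite mulVKg.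
    by move=> x; exact: mule_ge0.
  by rewrite muleA -EFinM mulVf ?mul1e// gt_eqF.
rewrite -(@fubini_radon _ _ lccbE mu pi
    (fun p => f p.1 * ((c p.2)^-1%:E * h ((p.2 : E)^-1 * p.1)%g)))//; last 2 first.
- apply: emeasurable_funM; first exact: (measurableT_comp mf).
  by apply: emeasurable_funM => //; exact: (measurableT_comp mcV).
- by move=> p; rewrite mule_ge0// mule_ge0// lee_fin invr_ge0 ltW.
apply: eq_integral => x _ /=; rewrite ge0_integralZl//.
- apply: emeasurable_funM => //; apply: (measurableT_comp mh).
  by apply: measurable_fun_mulg => //; exact: measurable_inverse.
- by move=> y _; rewrite mule_ge0// lee_fin invr_ge0 ltW.
Qed.

Lemma integral_compact_bounds nu (d : E -> R) (S : set E) :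
  finite_on_compacts nu -> continuous d -> (forall x, 0 < d x)%R ->
  compact S -> 0 < nu S ->
  0 < \int[nu]_x ((d x)%:E * (\1_S x)%:E) < +oo.
Proof.
move=> nufin cd d_gt0 cS nuS.
have S0 : S !=set0.
  by apply/set0P; apply: contraTneq nuS => ->; rewrite measure0 ltxx.
have mS := compact_borel lccbE cS.
have mS1 : measurable_fun setT (fun x : borel E => (\1_S x)%:E : \bar R).
  by apply/measurable_EFinP; exact: measurable_indic.
have md : measurable_fun setT (fun x : borel E => (d x)%:E).
  by apply/measurable_EFinP; exact: continuous_borel_real.
have int1 k : (0 <= k)%R -> \int[nu]_x (k%:E * (\1_S x)%:E) = k%:E * nu S.
  move=> k0; rewrite ge0_integralZl ?lee_fin//.
  by rewrite integral_indic// setIT.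
have d1_ge0 x : 0 <= (d x)%:E * (\1_S x)%:E.
  by rewrite mule_ge0 ?lee_fin// ltW.
apply/andP; split.
  have cdS : {within S, continuous d} by exact: continuous_subspaceT.
  have [a _ da] := compact_EVT_min S0 cS cdS.
  apply: (@lt_le_trans _ _ ((d a)%:E * nu S)); first by apply: mule_gt0; rewrite ?lte_fin.
  rewrite -(int1 _ (ltW (d_gt0 a))); apply: ge0_le_integral => //.
  - by move=> x _; rewrite mule_ge0 ?lee_fin// ltW.
  - exact: emeasurable_funM.
  - exact: emeasurable_funM.
  move=> x _; rewrite indicE; have [xS|xS] := boolP (x \in S); last by rewrite !mule0.
  by rewrite !mule1 lee_fin da.
have cdS : {within S, continuous d} by exact: continuous_subspaceT.
have [b _ db] := compact_EVT_max S0 cS cdS.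
apply: (@le_lt_trans _ _ ((d b)%:E * nu S)); last first.
  by rewrite lte_mul_pinfty ?lee_fin ?ltW//; exact: nufin.
rewrite -(int1 _ (ltW (d_gt0 b))); apply: ge0_le_integral => //.
- exact: emeasurable_funM.
- exact: emeasurable_funM.
move=> x _; rewrite indicE; have [xS|xS] := boolP (x \in S); last by rewrite !mule0.
by rewrite !mule1 lee_fin db.
Qed.

(** In [haar_product_identity] take for [h] the indicator of a compact
    neighbourhood [K] of the identity.  The inner integral [W x] is then positive
    and finite, because [x K^-1] is compact with nonempty interior and [1/c] is
    bounded above and below on it.  Hence the identity can be solved for [mu]: it
    is [mu K] times the measure of density [1/W] with respect to [pi], which is
    the same for [mu1] and [mu2].  Positivity of [mu K] comes out of this formula
    as well, since [mu] is not zero. *)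
Lemma left_scaling_unique pi mu1 mu2 (c : E -> R) : right_Haar pi ->
  continuous c -> (forall g, 0 < c g)%R ->
  nonzero_radon mu1 -> nonzero_radon mu2 ->
  left_scaling c mu1 -> left_scaling c mu2 -> proportional mu1 mu2.
Proof.
move=> Hpi cc c_gt0 mu1R mu2R mu1c mu2c; have [_ pifin _] := Hpi.
have [hE lcE scE] := lccbE.
have [K cK] := locally_compact_nbhs 1%g lcE.
rewrite nbhsE => -[U [oU U1] UK].
have mK := compact_borel lccbE cK.
have mK1 : measurable_fun setT (fun x : borel E => (\1_K x)%:E : \bar R).
  by apply/measurable_EFinP; exact: measurable_indic.
have ccV : continuous (fun x : E => (c x)^-1%R).
  by move=> x; apply: continuousV; [rewrite gt_eqF|exact: cc].
have cV_gt0 x : (0 < (c x)^-1)%R by rewrite invr_gt0.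
have mcV : measurable_fun setT (fun x : borel E => (c x)^-1%:E).
  by apply/measurable_EFinP; exact: continuous_borel_real.
pose W (x : borel E) := \int[pi]_y ((c y)^-1%:E * (\1_K ((y : E)^-1 * x)%g)%:E).
have W_bounds x : 0 < W x < +oo.
  pose S := (fun y : E => (y^-1 * x)%g) @^-1` K.
  have cS : compact S by exact: compact_preimage_invg_mul.
  apply: (@integral_compact_bounds pi (fun y => (c y)^-1%R) S) => //.
  have oUx : open ((fun y : E => (y^-1 * x)%g) @^-1` U).
    by apply: open_comp => // y _; exact: continuous_invg_mul.
  apply: (@lt_le_trans _ _ (pi ((fun y : E => (y^-1 * x)%g) @^-1` U))).
    apply: (right_Haar_open_gt0 Hpi) => //.
    by exists x; rewrite /preimage/= mulVg.
  apply: le_measure => [||y]; last exact: UK.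
    by rewrite inE; exact: open_borel.
  by rewrite inE; exact: compact_borel.
have mW : measurable_fun setT W.
  apply: (measurable_integral_radon lccbE (f := fun p : borel E * borel E =>
    (c p.2)^-1%:E * (\1_K ((p.2 : E)^-1 * p.1)%g)%:E)) => //.
    apply: emeasurable_funM; first exact: (measurableT_comp mcV).
    apply: (measurableT_comp mK1); apply: measurable_fun_mulg => //.
    exact: measurable_fun_invg.
  by move=> p; rewrite mule_ge0// lee_fin// ltW.
have fW_gt0 x : (0 < fine (W x))%R by rewrite fine_gt0.
pose w x := ((fine (W x))^-1)%R.
have wW x : (w x)%:E * W x = 1.
  have /andP[W0 Woo] := W_bounds x.
  by rewrite -[X in _ * X]fineK ?gt0_fin_numE// -EFinM mulVf// gt_eqF.
have mw : measurable_fun setT (fun x : borel E => (w x)%:E).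
  apply/measurable_EFinP; apply: measurable_fun_inv_gt0 => //.
  exact: (measurableT_comp (fine_measurable measurableT)).
have w_ge0 x : 0 <= (w x)%:E by rewrite lee_fin invr_ge0 ltW.
pose I (A : set (borel E)) := \int[pi]_x ((\1_A x)%:E * (w x)%:E).
have key mu : nonzero_radon mu -> left_scaling c mu ->
    exists2 m : R, (0 < m)%R & forall A : set (borel E), measurable A ->
      mu A = m%:E * I A.
  move=> [mu_gt0 mufin] muc.
  have muI (A : set (borel E)) : measurable A -> mu A = mu K * I A.
    move=> mA.
    have mA1 : measurable_fun setT (fun x : borel E => (\1_A x)%:E : \bar R).
      by apply/measurable_EFinP; exact: measurable_indic.
    have := haar_product_identity Hpi mufin muc _ c_gt0
      (emeasurable_funM mA1 mw) _ mK1 _.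
    rewrite integral_indic// setIT muleC => ->.
    - rewrite -[in LHS](setIT A) -integral_indic//.
      by apply: eq_integral => x _; rewrite -muleA wW mule1.
    - exact: continuous_borel_real.
    - by move=> x; rewrite mule_ge0// lee_fin.
    - by move=> x; rewrite lee_fin.
  have muK_gt0 : 0 < mu K.
    rewrite lt_neqAle measure_ge0 andbT eq_sym.
    by apply: contraTN mu_gt0 => /eqP K0; rewrite (muI setT)// K0 mul0e ltxx.
  exists (fine (mu K)); first by rewrite fine_gt0// muK_gt0 mufin.
  move=> A mA; rewrite fineK; first exact: muI.
  by rewrite gt0_fin_numE// mufin.
have [m1 m1_gt0 mu1E] := key _ mu1R mu1c.
have [m2 m2_gt0 mu2E] := key _ mu2R mu2c.
exists (m1 / m2)%R; first exact: divr_gt0.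
by move=> A mA; rewrite mu1E// mu2E// muleA -EFinM divfK// gt_eqF.
Qed.

(** For each [h], the measure [A |-> pi (h A^-1)] is left invariant.  Uniqueness
    compares the one for [h = g] with the one for [h = 1], and applying the result
    to [A^-1] turns this into [pi (gA) = k pi A]. *)
Lemma right_Haar_quasi_invariant pi : right_Haar pi ->
  forall g : E, exists2 k : R, (0 < k)%R &
    forall A : set (borel E), measurable A ->
      pi ((fun x : E => (g^-1 * x)%g) @^-1` A) = k%:E * pi A.
Proof.
move=> Hpi g; have [pi_gt0 pifin _] := Hpi; have [_ _ scE] := lccbE.
have mT h : measurable_fun setT ((fun x : E => (x^-1 * h)%g) : borel E -> borel E).
  by apply: measurable_fun_mulg => //; exact: measurable_fun_invg.
have lam_ex h : exists lam, [/\ nonzero_radon lam, left_scaling (fun=> 1%R) lam &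
    forall A, lam A = pi ((fun x : E => (x^-1 * h)%g) @^-1` A)].
  have [lam [lamE _]] := pushforward_measure pi (mT h).
  exists lam; split => //.
    split; first by rewrite lamE preimage_setT.
    move=> K cK; rewrite lamE; apply: pifin.
    exact: compact_preimage_invg_mul.
  move=> a A mA; rewrite !lamE mul1e -[RHS](right_Haar_preimage Hpi a); last first.
    by rewrite -[X in measurable X]setTI; exact: mT.
  by congr (pi _); apply/seteqP; split=> x; rewrite /preimage/= invgM !mulgA.
have [lam1 [lam1R lam1c lam1E]] := lam_ex 1%g.
have [lamg [lamgR lamgc lamgE]] := lam_ex g.
have cont1 : continuous (fun _ : E => 1%R : R) by move=> x; exact: cvg_cst.
have [k k_gt0 kE] := left_scaling_unique Hpi
  cont1 (fun=> ltr01) lamgR lam1R lamgc lam1c.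
exists k => // A mA.
have mAV : measurable ((@inverse E) @^-1` A).
  by rewrite -[X in measurable X]setTI; exact: measurable_inverse.
have := kE _ mAV; rewrite lamgE lam1E => kA.
transitivity (pi ((fun x : E => (x^-1 * g)%g) @^-1` (@inverse E @^-1` A))).
  congr (pi _); apply/seteqP.
  by split=> x; rewrite /preimage/inverse/= invgM invgK.
rewrite kA; congr (_ * pi _); apply/seteqP.
by split=> x; rewrite /preimage/inverse/= mulg1 invgK.
Qed.

End relative_invariance.

(** * Continuity of the scaling factor *)

Section scaling_factors.
Local Open Scope ereal_scope.
Context (R : realType) (E : topGroupType) (lccbE : lccb_group E).
Implicit Types pi mu nu : {measure set (borel E) -> \bar R}.

Lemma multiplicative1 (c : E -> R) : (forall x, 0 < c x)%R ->
  (forall x y, c (x * y)%g = (c x * c y)%R) -> c 1%g = 1%R.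
Proof.
move=> c_gt0 cM; apply: (mulfI (lt0r_neq0 (c_gt0 1%g))).
by rewrite -cM mulg1 mulr1.
Qed.

Lemma multiplicativeV (c : E -> R) : (forall x, 0 < c x)%R ->
  (forall x y, c (x * y)%g = (c x * c y)%R) ->
  forall x, c (x^-1)%g = (c x)^-1%R.
Proof.
move=> c_gt0 cM x; apply: (mulfI (lt0r_neq0 (c_gt0 x))).
by rewrite -cM mulgV (multiplicative1 c_gt0 cM) mulfV// gt_eqF.
Qed.

(** A bound from above near the identity suffices, since [c(g^-1) = 1/c(g)] turns
    it into a bound from below. *)
Lemma multiplicative_usc_continuous (c : E -> R) : (forall x, 0 < c x)%R ->
  (forall x y, c (x * y)%g = (c x * c y)%R) ->
  (forall e : R, (0 < e)%R -> \forall g \near (1%g : E), (c g < 1 + e)%R) ->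
  continuous c.
Proof.
move=> c_gt0 cM usc; have cV := multiplicativeV c_gt0 cM.
move=> x0; apply/cvgrPdist_lt => e e_gt0.
have d_gt0 : (0 < e / c x0)%R by rewrite divr_gt0.
have cont1 : \forall t \near (1%g : E), (`|1 - c t| < e / c x0)%R.
  have uscV : \forall t \near (1%g : E), (c (t^-1)%g < 1 + e / c x0)%R.
    have inv1 := @invg_continuous E 1%g; rewrite /continuous_at invg1 in inv1.
    exact: (inv1 _ (usc _ d_gt0)).
  near=> t.
  have ct : (c t < 1 + e / c x0)%R by near: t; exact: usc.
  have : (c (t^-1)%g < 1 + e / c x0)%R by near: t.
  have t_gt0 := c_gt0 t; rewrite cV -div1r ltr_pdivrMr//.
  move: ct t_gt0 (d_gt0); rewrite ltr_norml.
  move: (c t) (e / c x0)%R => a d; nra.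
have : \forall x \near x0, (`|1 - c (x0^-1 * x)%g| < e / c x0)%R.
  have cx := @continuous_lmul _ (x0^-1)%g x0.
  rewrite /continuous_at mulVg in cx; exact: (cx _ cont1).
apply: filterS => x; rewrite cM cV.
rewrite ltr_pdivlMr// -[X in (_ * X)%R]gtr0_norm// -normrM mulrBl mul1r.
by rewrite [(_ * c x)%R]mulrC mulfVK// gt_eqF.
Unshelve. all: by end_near. Qed.

(** Let [V n] shrink to the identity.  The open sets [V n K] decrease to [K],
    because [K] is closed, and the first of them has finite measure, because it is
    relatively compact.  So [mu (V n K)] tends to [mu K], and [gK] is contained in
    [V n K] for [g] in [V n]. *)
Lemma measure_lmul_usc mu (K : set E) (e : R) : finite_on_compacts mu ->
  compact K -> 0 < mu K -> (0 < e)%R ->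
  \forall g \near (1%g : E),
    mu ((fun x : E => (g^-1 * x)%g) @^-1` K) < (1 + e)%:E * mu K.
Proof.
move=> mufin cK muK_gt0 e_gt0; have [hE lcE scE] := lccbE.
have mK := compact_borel lccbE cK.
have muKfin : mu K \is a fin_num by rewrite gt0_fin_numE//; exact: mufin.
have [C cC] := locally_compact_nbhs 1%g lcE.
rewrite nbhsE => -[U [oU U1] UC].
have [V [oV V1 VS V0 Vbase]] := nested_nbhs_base scE oU U1.
pose VK n := \bigcup_(k in K) [set x : E | V n (x * k^-1)%g].
have oVK n : open (VK n).
  apply: bigcup_open => k _; apply: (@open_comp _ _ (fun x : E => (x * k^-1)%g)) => // x _.
  exact: continuous_rmul.
have capVK : \bigcap_n VK n = K.
  apply/seteqP; split=> [x VKx|x Kx n _]; last by exists x; rewrite //= mulgV.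
  suff : closure K x by rewrite -(closure_id K).1//; exact: compact_closed.
  move=> B xB.
  have : nbhs (1%g : E) ((fun v : E => v^-1 * x)%g @^-1` B).
    by apply: continuous_invg_mul; rewrite invg1 mul1g.
  move=> /Vbase[n VnB]; have [k Kk Vk] := VKx n I.
  exists k; split => //; have := VnB _ Vk.
  by rewrite /preimage/= invgM invgK mulgVK.
have VK0fin : mu (VK 0%N) < +oo.
  apply: le_lt_trans (mufin _ (compact_mul cC cK)); apply: le_measure.
  - by rewrite inE; exact: open_borel.
  - by rewrite inE; apply: compact_borel => //; exact: compact_mul.
  - move=> x [k Kk /=]; rewrite V0 => /UC Cxk.
    by exists ((x * k^-1)%g, k) => //=; rewrite mulgVK.
have cvgVK : mu (VK n) @[n --> \oo] --> mu K.
  rewrite -capVK; apply: nonincreasing_cvg_mu => //.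
  - by move=> n; exact: open_borel.
  - by rewrite capVK.
  - move=> n m nm; apply/subsetPset => x [k Kk Vk]; exists k => //.
    move: Vk; rewrite /= -(subnK nm); elim: (m - n)%N => // i IH.
    by move=> /VS; exact: IH.
have [n VKn] : exists n, mu (VK n) < (1 + e)%:E * mu K.
  have nbhsK : nbhs (mu K) [set z | z < (1 + e)%:E * mu K].
    apply: open_nbhs_nbhs; split; first exact: open_ereal_lt_ereal.
    rewrite /= -(fineK muKfin) -EFinM lte_fin mulrDl mul1r ltrDl.
    by apply: mulr_gt0 => //; rewrite fine_gt0// muK_gt0 mufin.
  by have [n _ VKn] := cvgVK _ nbhsK; exists n; apply: VKn => /=.
apply: (filterS _ (open_nbhs_nbhs (conj (oV n) (V1 n)))) => g Vg.
apply: le_lt_trans VKn; apply: le_measure.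
- by rewrite inE -[X in measurable X]setTI; exact: measurable_lmul.
- by rewrite inE; exact: open_borel.
- move=> x Kx; exists (g^-1 * x)%g => //=.
  by rewrite invgM invgK mulgA mulgV mul1g.
Qed.

(** Scaling factors multiply, as one sees on a compact set of positive measure;
    their continuity is [measure_lmul_usc] on that set. *)
Lemma left_scaling_exponential mu : nonzero_radon mu ->
  (forall g : E, exists2 k : R, (0 < k)%R &
    forall A : set (borel E), measurable A ->
      mu ((fun x : E => (g^-1 * x)%g) @^-1` A) = k%:E * mu A) ->
  exists c : E -> R, [/\ exponential c, continuous c & left_scaling c mu].
Proof.
move=> [mu_gt0 mufin] muq.
have /choice[c cP] : forall g : E, exists k : R, (0 < k)%R /\
    forall A : set (borel E), measurable A ->
      mu ((fun x : E => (g^-1 * x)%g) @^-1` A) = k%:E * mu A.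
  by move=> g; have [k k0 kE] := muq g; exists k.
have c_gt0 g : (0 < c g)%R := (cP g).1.
have muc : left_scaling c mu by move=> g A mA; exact: (cP g).2.
have [K cK muK_gt0] := exists_compact_gt0 lccbE mu_gt0.
have mK := compact_borel lccbE cK.
have muKfin : mu K \is a fin_num by rewrite gt0_fin_numE//; exact: mufin.
have mK_gt0 : (0 < fine (mu K))%R by rewrite fine_gt0// muK_gt0 mufin.
have cM x y : c (x * y)%g = (c x * c y)%R.
  have : (c (x * y)%g)%:E * mu K = (c x)%:E * ((c y)%:E * mu K).
    rewrite -!muc//; last by rewrite -[X in measurable X]setTI; exact: measurable_lmul.
    by congr (mu _); apply/seteqP; split=> z; rewrite /preimage/= invgM mulgA.
  rewrite muleA -(fineK muKfin) -!EFinM => -[].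
  exact: (mulIf (lt0r_neq0 mK_gt0)).
have usc (e : R) : (0 < e)%R -> \forall g \near (1%g : E), (c g < 1 + e)%R.
  move=> /(measure_lmul_usc mufin cK muK_gt0); apply: filterS => g.
  by rewrite muc// -(fineK muKfin) -!EFinM lte_fin ltr_pM2r.
have cc := multiplicative_usc_continuous c_gt0 cM usc.
exists c; split => //; split => //; exact: continuous_borel_real.
Qed.

End scaling_factors.

(** * Exponential densities *)

Section exponential_densities.
Local Open Scope ereal_scope.
Context (R : realType) (E : topGroupType) (lccbE : lccb_group E).
Implicit Types pi mu nu : {measure set (borel E) -> \bar R}.
Implicit Types (v : probability (borel E) R) (phi psi c : E -> R).

Lemma exponential_inv phi : exponential phi -> exponential (fun x => (phi x)^-1%R).
Proof.
move=> [mphi phi_gt0 phiM]; split => [|x|x y].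
- exact: measurable_fun_inv_gt0.
- by rewrite invr_gt0.
- by rewrite phiM invfM.
Qed.

Lemma continuous_exponential_inv phi : (forall x, 0 < phi x)%R ->
  continuous phi -> continuous (fun x => (phi x)^-1%R).
Proof.
by move=> phi_gt0 cphi x; apply: continuousV; [rewrite gt_eqF|exact: cphi].
Qed.

Lemma exponential_div phi psi : exponential phi -> exponential psi ->
  exponential (fun x => phi x / psi x)%R.
Proof.
move=> ephi /exponential_inv[mpsi psi_gt0 psiM]; case: ephi => mphi phi_gt0 phiM.
split => [|x|x y]; first exact: measurable_funM.
- exact: mulr_gt0.
- by rewrite phiM psiM mulrACA.
Qed.

Lemma density_indic mu (f : E -> R) (A : set E) :
  measurable (A : set (borel E)) ->
  density f mu A = \int[mu]_x ((\1_A x)%:E * (f x)%:E).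
Proof.
move=> mA; rewrite /density integral_mkcond; apply: eq_integral => x _.
rewrite patchE indicE; case: ifPn => _; by rewrite ?mul1e ?mul0e.
Qed.

Lemma density_dominated mu nu (f : E -> R) :
  measurable_fun setT (f : borel E -> R) ->
  (forall A : set (borel E), measurable A -> nu A = density f mu A) ->
  nu `<< mu.
Proof.
move=> mf nuE N muN A mA AN; rewrite nuE//; apply: null_set_integral => //.
- by apply/measurable_EFinP; exact: measurable_funTS.
- exact: muN.
Qed.

Lemma density_finite_on_compacts mu nu (f : E -> R) :
  continuous f -> (forall x, 0 < f x)%R -> finite_on_compacts mu ->
  (forall A : set (borel E), measurable A -> nu A = density f mu A) ->
  finite_on_compacts nu.
Proof.
move=> cf f_gt0 mufin nuE K cK; have mK := compact_borel lccbE cK.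
have [K0|K_gt0] := eqVneq (mu K) 0.
  have /(_ K) -> // := density_dominated (continuous_borel_real cf) nuE.
  exact/measure0_null_setP.
rewrite nuE// density_indic//; under eq_integral do rewrite muleC.
have muK_gt0 : 0 < mu K by rewrite lt_neqAle eq_sym K_gt0 measure_ge0.
by have /andP[] := integral_compact_bounds lccbE mufin cf f_gt0 cK muK_gt0.
Qed.

Lemma density_setT_gt0 mu (f : E -> R) : continuous f -> (forall x, 0 < f x)%R ->
  nonzero_radon mu -> 0 < density f mu setT.
Proof.
move=> cf f_gt0 [mu_gt0 mufin].
have [K cK muK_gt0] := exists_compact_gt0 lccbE mu_gt0.
have mK := compact_borel lccbE cK.
have /andP[fK_gt0 _] := integral_compact_bounds lccbE mufin cf f_gt0 cK muK_gt0.
have mf : measurable_fun setT (fun x : borel E => (f x)%:E).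
  by apply/measurable_EFinP; exact: continuous_borel_real.
apply: (lt_le_trans fK_gt0); apply: ge0_le_integral => //.
- by move=> x _; rewrite mule_ge0// lee_fin// ltW.
- by apply: emeasurable_funM => //; apply/measurable_EFinP; exact: measurable_indic.
- move=> x _; rewrite -EFinM lee_fin; apply: ler_piMr; first exact: ltW.
  by rewrite indicE; case: (x \in K).
Qed.

(** The preimage of [A] under [x |-> x g] is [A g^-1]; this is the convention in
    which the measure [phi^-1 pi] is scaled by [phi] and not by its inverse. *)
Definition right_scaling phi mu :=
  forall (g : E) (A : set (borel E)), measurable A ->
    mu ((fun x : E => (x * g)%g) @^-1` A) = (phi g)%:E * mu A.

Lemma density_left_scaling mu nu c psi : exponential psi -> exponential c ->
  left_scaling c mu ->
  (forall A : set (borel E), measurable A -> nu A = density psi mu A) ->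
  left_scaling (fun x => psi x * c x)%R nu.
Proof.
move=> [mpsi psi_gt0 psiM] [_ c_gt0 _] muc nuE g A mA.
rewrite !nuE//; last by rewrite -[X in measurable X]setTI; exact: measurable_lmul.
rewrite !density_indic//; last first.
  by rewrite -[X in measurable X]setTI; exact: measurable_lmul.
have mApsi : measurable_fun setT (fun x : borel E => (\1_A x)%:E * (psi x)%:E).
  apply: emeasurable_funM; apply/measurable_EFinP => //.
have Apsi0 x : 0 <= (\1_A x)%:E * (psi x)%:E by rewrite mule_ge0// lee_fin ?ltW.
rewrite EFinM -muleA -(left_scaling_integral c_gt0 muc)//.
rewrite -ge0_integralZl ?lee_fin ?(ltW (psi_gt0 g))//; last first.
  by apply: (measurableT_comp mApsi); exact: measurable_lmul.
apply: eq_integral => x _; rewrite muleCA; congr (_ * _).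
by rewrite -EFinM -psiM mulVKg.
Qed.

Lemma density_right_scaling pi nu phi : right_Haar pi -> exponential phi ->
  (forall A : set (borel E), measurable A ->
    nu A = density (fun x => (phi x)^-1%R) pi A) ->
  right_scaling phi nu.
Proof.
move=> Hpi ephi nuE g A mA; have [_ phi_gt0 _] := ephi.
have [mpsi psi_gt0 psiM] := exponential_inv ephi.
rewrite !nuE//; last by rewrite -[X in measurable X]setTI; exact: measurable_rmul.
rewrite !density_indic//; last first.
  by rewrite -[X in measurable X]setTI; exact: measurable_rmul.
have mApsi : measurable_fun setT (fun x : borel E => (\1_A x)%:E * (phi x)^-1%:E).
  apply: emeasurable_funM; apply/measurable_EFinP => //.
have Apsi0 x : 0 <= (\1_A x)%:E * (phi x)^-1%:E.
  by rewrite mule_ge0// lee_fin ?ltW.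
rewrite -(right_Haar_integral Hpi g mApsi)//.
rewrite -ge0_integralZl ?lee_fin ?(ltW (phi_gt0 g))//; last first.
  by apply: (measurableT_comp mApsi); exact: measurable_rmul.
apply: eq_integral => x _; rewrite muleCA; congr (_ * _).
by rewrite -EFinM psiM mulrCA mulfV ?mulr1// gt_eqF.
Qed.

Lemma right_scaling_unique mu nu phi phi' : nonzero_radon mu ->
  right_scaling phi mu -> right_scaling phi' nu -> proportional mu nu ->
  phi = phi'.
Proof.
move=> [mu_gt0 mufin] muphi nuphi [k k_gt0 kE].
have [K cK muK_gt0] := exists_compact_gt0 lccbE mu_gt0.
have mK := compact_borel lccbE cK.
have muKfin : mu K \is a fin_num by rewrite gt0_fin_numE//; exact: mufin.
have mK_gt0 : (0 < fine (mu K))%R by rewrite fine_gt0// muK_gt0 mufin.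
apply/funext => g; have : (phi g)%:E * mu K = (phi' g)%:E * mu K.
  have mgK : measurable ((fun x : E => (x * g)%g) @^-1` K : set (borel E)).
    by rewrite -[X in measurable X]setTI; exact: measurable_rmul.
  by rewrite -muphi// kE// nuphi// muleCA -kE.
rewrite -(fineK muKfin) -!EFinM => -[]; exact: (mulIf (lt0r_neq0 mK_gt0)).
Qed.

Lemma proportional_right_scaling mu nu phi :
  right_scaling phi nu -> proportional mu nu -> right_scaling phi mu.
Proof.
move=> nuphi [k _ kE] g A mA; rewrite kE; last first.
  by rewrite -[X in measurable X]setTI; exact: measurable_rmul.
by rewrite nuphi// muleCA -kE.
Qed.

End exponential_densities.

(** * One step of the random walk *)

Section random_walk_step.
Local Open Scope ereal_scope.
Context (R : realType) (E : topGroupType) (lccbE : lccb_group E).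
Implicit Types pi mu nu : {measure set (borel E) -> \bar R}.
Implicit Types (v : probability (borel E) R) (phi psi c : E -> R).

Lemma stepE v (x : E) (A : set (borel E)) : measurable A ->
  step v x A = \int[v]_y (\1_A ((x : E) * (y : E))%g)%:E.
Proof.
move=> mA; rewrite /step.
have -> : [set (x^-1 * a)%g | a in A] = (fun y : E => (x * y)%g) @^-1` A.
  apply/seteqP; split=> [_ [a Aa <-]|y Ay]; first by rewrite /preimage/= mulVKg.
  by exists (x * y)%g => //; rewrite mulKg.
rewrite -[X in v X]setIT -integral_indic//.
by rewrite -[X in measurable X]setTI; exact: measurable_lmul.
Qed.

Lemma probability_finite_on_compacts v : finite_on_compacts v.
Proof.
move=> K cK; apply: (@le_lt_trans _ _ 1); last exact: ltry.
by apply: probability_le1; exact: compact_borel.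
Qed.

Lemma measurable_fun_indic_mul (A : set (borel E)) : measurable A ->
  measurable_fun setT (fun p : borel E * borel E =>
    (\1_A ((p.1 : E) * p.2)%g)%:E : \bar R).
Proof.
move=> mA; have [_ _ scE] := lccbE; apply/measurable_EFinP.
have m1A : measurable_fun setT (\1_A : borel E -> R) by exact: measurable_indic.
apply: (measurableT_comp m1A).
exact: measurable_fun_mulg.
Qed.

Lemma measurable_step v (A : set (borel E)) : measurable A ->
  measurable_fun setT (fun x : borel E => step v x A).
Proof.
move=> mA; under eq_fun do rewrite stepE//.
apply: (measurable_integral_radon lccbE
  (probability_finite_on_compacts v) (measurable_fun_indic_mul mA)).
by move=> p; rewrite lee_fin.
Qed.

(** By Tonelli, [mu P] of [A] is the integral over [v(dy)] of [mu (A y^-1)], and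
    [mu (A y^-1) = phi(y) mu A]. *)
Lemma right_scaling_step v mu phi (A : set (borel E)) :
  exponential phi -> finite_on_compacts mu -> right_scaling phi mu ->
  measurable A ->
  measure_step v mu A = (\int[v]_x (phi x)%:E) * mu A.
Proof.
move=> [mphi phi_gt0 _] mufin muphi mA; rewrite /measure_step.
under eq_integral do rewrite stepE//.
rewrite (fubini_radon lccbE mufin (probability_finite_on_compacts v)
  (measurable_fun_indic_mul mA))//.
rewrite -ge0_integralZr//; last 2 first.
- exact/measurable_EFinP.
- by move=> x _; rewrite lee_fin ltW.
apply: eq_integral => y _ /=; rewrite -muphi//.
rewrite -[X in mu X]setIT -integral_indic//.
by rewrite -[X in measurable X]setTI; exact: measurable_rmul.
Qed.

(** Both forms exclude an infinite integral, because [r] is positive. *)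
Lemma continuous_exponential_forP v (r : R) phi : (0 < r)%R ->
  continuous_exponential_for v r phi <->
  [/\ exponential phi, continuous phi & r%:E * \int[v]_x (phi x)%:E = 1].
Proof.
move=> r_gt0; have r0 : r != 0%R by rewrite gt_eqF.
split=> -[ephi cphi rE]; split => //.
  by rewrite -[X in _ * X]inveK -rE inver (negbTE r0) -EFinM mulfV.
have -> : \int[v]_x (phi x)%:E = (r^-1)%:E.
  by rewrite -[LHS]mul1e -(mulVf r0) EFinM -muleA rE mule1.
by rewrite inver invr_eq0 (negbTE r0) invrK.
Qed.

Lemma integral_dual_law v psi : exponential psi ->
  \int[dual_law v]_x (psi x)%:E = \int[v]_x (psi x)^-1%:E.
Proof.
move=> [mpsi psi_gt0 psiM]; rewrite ge0_integral_distribution; last 2 first.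
- exact/measurable_EFinP.
- by move=> x; rewrite lee_fin ltW.
by apply: eq_integral => x _; rewrite /inverse/= multiplicativeV.
Qed.

Lemma continuous_exponential_for_inv v (r : R) phi :
  continuous_exponential_for v r phi ->
  continuous_exponential_for (dual_law v) r (fun x => (phi x)^-1%R).
Proof.
move=> [ephi cphi rE]; have [_ phi_gt0 _] := ephi; split.
- exact: exponential_inv.
- exact: continuous_exponential_inv.
- rewrite integral_dual_law//; last exact: exponential_inv.
  by under eq_integral do rewrite invrK.
Qed.

Lemma continuous_exponential_for_dual v (r : R) psi :
  continuous_exponential_for (dual_law v) r psi ->
  continuous_exponential_for v r (fun x => (psi x)^-1%R).
Proof.
move=> [epsi cpsi rE]; have [_ psi_gt0 _] := epsi; split.
- exact: exponential_inv.
- exact: continuous_exponential_inv.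
- by rewrite -integral_dual_law.
Qed.

Lemma continuous_exponential_invariant pi v (r : R) phi : (0 < r)%R ->
  nonzero_radon pi -> continuous_exponential_for v r phi ->
  invariant_fun pi v r (EFin \o phi).
Proof.
move=> r_gt0 piR /(continuous_exponential_forP _ _ r_gt0)[[mphi phi_gt0 phiM] cphi rE].
split.
- exact/measurable_EFinP.
- by move=> x; rewrite lee_fin ltW.
- exact: density_setT_gt0.
- by exists 1%g.
move=> x; rewrite /transition_op/=.
under eq_integral do rewrite phiM EFinM.
rewrite ge0_integralZl ?lee_fin ?(ltW (phi_gt0 x))//.
- by rewrite muleCA rE mule1.
- exact/measurable_EFinP.
- by move=> y _; rewrite lee_fin ltW.
Qed.

End random_walk_step.

(** * Absolutely continuous invariant measures *)

Section invariant_measures.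
Local Open Scope ereal_scope.
Context (R : realType) (E : topGroupType) (lccbE : lccb_group E).
Context (pi : {measure set (borel E) -> \bar R}) (Hpi : right_Haar pi).
Context (v : probability (borel E) R) (r : R) (r_gt0 : (0 < r)%R).
Implicit Types (mu nu : {measure set (borel E) -> \bar R}) (phi : E -> R).

Lemma right_Haar_radon : nonzero_radon pi.
Proof. by case: Hpi. Qed.

(** The walk multiplies on the right, so its transition probabilities are
    unchanged when start and target are translated on the left. *)
Lemma ac_radon_invariant_lmul mu (g : E) : ac_radon_invariant_measure pi v r mu ->
  exists nu, ac_radon_invariant_measure pi v r nu /\
    forall A, nu A = mu ((fun x : E => (g^-1 * x)%g) @^-1` A).
Proof.
move=> [[mu_gt0 muE] mupi mufin].
have [nu [nuE nuint]] := pushforward_measure mu (@measurable_lmul E g^-1%g).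
have mT (A : set (borel E)) : measurable A ->
    measurable ((fun x : E => (g^-1 * x)%g) @^-1` A : set (borel E)).
  by move=> mA; rewrite -[X in measurable X]setTI; exact: measurable_lmul.
exists nu; split => //; split.
- split; first by rewrite nuE preimage_setT.
  move=> A mA; rewrite nuE muE; last exact: mT.
  congr (_ * _); rewrite /measure_step nuint; last 2 first.
  + exact: measurable_step.
  + by move=> x; exact: measure_ge0.
  apply: eq_integral => x _; rewrite /step; congr (v _).
  apply/seteqP; split=> [_ [a Aa <-]|_ [a Aa <-]].
    by exists (g^-1 * a)%g => //=; rewrite invgM invgK -mulgA mulVKg.
  exists (g * a)%g; first by rewrite /preimage/= mulKg.
  by rewrite /= invgM invgK mulgA.
- have [k _ kE] := right_Haar_quasi_invariant lccbE Hpi g.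
  move=> N piN A mA AN; rewrite nuE.
  have piA0 : pi ((fun x : E => (g^-1 * x)%g) @^-1` A) = 0.
    by rewrite kE// piN// mule0.
  by move/(measure0_null_setP _ (mT _ mA))/mupi : piA0; apply => //; exact: mT.
- move=> K cK; rewrite nuE; apply: mufin.
  apply: (@compact_preimage_can _ _ (fun x => g * x)%g) => //.
  + by move=> x; rewrite mulVKg.
  + by move=> x; rewrite mulKg.
  + exact: continuous_lmul.
Qed.

(** Evaluate the invariance of [mu] on a compact set of positive measure, where
    [right_scaling_step] allows one to divide by [mu K]. *)
Lemma invariant_right_scaling mu phi : exponential phi ->
  ac_radon_invariant_measure pi v r mu -> right_scaling phi mu ->
  r%:E * \int[v]_x (phi x)%:E = 1.
Proof.
move=> ephi [[mu_gt0 muE] _ mufin] muphi.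
have [K cK muK_gt0] := exists_compact_gt0 lccbE mu_gt0.
have mK := compact_borel lccbE cK.
have muKfin : mu K \is a fin_num by rewrite gt0_fin_numE//; exact: mufin.
have := muE _ mK.
rewrite (right_scaling_step lccbE v ephi mufin muphi mK) muleA.
have mK_gt0 : (0 < fine (mu K))%R by rewrite fine_gt0// muK_gt0 mufin.
rewrite -(fineK muKfin); case: (r%:E * _) => [s| |].
- rewrite -EFinM => -[sE]; congr EFin.
  by apply: (mulIf (lt0r_neq0 mK_gt0)); rewrite -sE mul1r.
- by rewrite gt0_mulye ?lte_fin.
- by rewrite gt0_mulNye ?lte_fin.
Qed.

Lemma density_ac_radon_invariant phi : continuous_exponential_for v r phi ->
  exists nu, [/\ ac_radon_invariant_measure pi v r nu,
    right_scaling phi nu &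
    forall A, nu A = density (fun x => (phi x)^-1%R) pi A].
Proof.
move=> /(continuous_exponential_forP _ _ r_gt0)[ephi cphi rE].
have [_ phi_gt0 _] := ephi; have [mpsi psi_gt0 _] := exponential_inv ephi.
have cpsi := continuous_exponential_inv phi_gt0 cphi.
have [nu nuE] := density_measure pi mpsi (fun x => ltW (psi_gt0 x)).
have nuE' (A : set (borel E)) (mA : measurable A) := nuE A.
have [_ pifin] := right_Haar_radon.
have nufin := density_finite_on_compacts lccbE cpsi psi_gt0 pifin nuE'.
have nuphi := density_right_scaling Hpi ephi nuE'.
exists nu; split => //; split => //; last exact: density_dominated nuE'.
split; first by rewrite nuE; exact: density_setT_gt0 right_Haar_radon.
move=> A mA; rewrite (right_scaling_step lccbE v ephi nufin nuphi mA).
by rewrite muleA rE mul1e.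
Qed.

End invariant_measures.

Theorem theorem1 (R : realType) (E : topGroupType) (lccbE : lccb_group E)
    (pi : {measure set (borel E) -> \bar R}) (haar_pi : right_Haar pi)
    (v : probability (borel E) R) (r : R) (r_gt0 : 0 < r)
    (pi0 : {measure set (borel E) -> \bar R})
    (pi0_inv : ac_radon_invariant_measure pi v r pi0)
    (pi0_uniq : forall nu1 nu2 : {measure set (borel E) -> \bar R},
       ac_radon_invariant_measure pi v r nu1 ->
       ac_radon_invariant_measure pi v r nu2 ->
       proportional nu1 nu2) :
  exists phi : E -> R,
    let psi := fun x => (phi x)^-1 in
    [/\ unique (continuous_exponential_for v r) phi,
        unique (continuous_exponential_for (dual_law v) r) psi,
        invariant_fun pi v r (EFin \o phi)
          /\ invariant_fun pi (dual_law v) r (EFin \o psi) &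
        proportional pi0 (density psi pi)].
Proof.
have piR := right_Haar_radon haar_pi.
have pi0R : nonzero_radon pi0 by case: pi0_inv => -[].
have [c0 [ec0 cc0 pi0c0]] : exists c0 : E -> R,
    [/\ exponential c0, continuous c0 & left_scaling c0 pi0].
  apply: left_scaling_exponential => // g.
  have [nu [nu_inv nuE]] := ac_radon_invariant_lmul lccbE haar_pi g pi0_inv.
  have [k k_gt0 kE] := pi0_uniq _ _ nu_inv pi0_inv.
  by exists k => // A mA; rewrite -nuE kE.
have [c [ec cc pic]] := left_scaling_exponential lccbE piR
  (right_Haar_quasi_invariant lccbE haar_pi).
have [[_ c0_gt0 _] [_ c_gt0 _]] := (ec0, ec).
(* with this choice, [psi pi] is scaled by [psi c = c0], exactly as [pi0] is *)
pose phi x := (c x / c0 x)%R; pose psi x := ((phi x)^-1)%R.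
have ephi : exponential phi by exact: exponential_div.
have [_ phi_gt0 _] := ephi.
have cphi : continuous phi.
  move=> x; apply: cvgM; first exact: cc.
  exact: (continuous_exponential_inv c0_gt0).
have epsi := exponential_inv ephi; have [mpsi psi_gt0 _] := epsi.
have cpsi := continuous_exponential_inv phi_gt0 cphi.
have [nu nuE] := density_measure pi mpsi (fun x => ltW (psi_gt0 x)).
have nuE' (A : set (borel E)) (mA : measurable A) := nuE A.
have nuR : nonzero_radon nu.
  split; first by rewrite nuE; exact: density_setT_gt0.
  by apply: density_finite_on_compacts nuE' => //; case: piR.
have pi0nu : proportional pi0 nu.
  apply: (left_scaling_unique lccbE haar_pi cc0 c0_gt0) => //.
  have := density_left_scaling epsi ec pic nuE'.
  rewrite (_ : (fun x => _) = c0)//; apply/funext => x.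
  by rewrite /phi invf_div divfK// gt_eqF.
have pi0phi : right_scaling phi pi0.
  apply: proportional_right_scaling pi0nu.
  exact: density_right_scaling haar_pi ephi nuE'.
have phi_for : continuous_exponential_for v r phi.
  apply/continuous_exponential_forP => //; split => //.
  exact: (invariant_right_scaling lccbE ephi pi0_inv).
have phi_uniq phi' : continuous_exponential_for v r phi' -> phi = phi'.
  move=> /(density_ac_radon_invariant lccbE haar_pi r_gt0)[nu' [nu'_inv nu'phi' _]].
  apply: (right_scaling_unique lccbE pi0R pi0phi nu'phi').
  exact: pi0_uniq pi0_inv nu'_inv.
exists phi => /=; split => //.
- split; first exact: continuous_exponential_for_inv.
  move=> psi' /continuous_exponential_for_dual/phi_uniq ->.
  by apply/funext => x; rewrite invrK.
- split; apply: continuous_exponential_invariant => //.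
  exact: continuous_exponential_for_inv.
- by have [k k_gt0 kE] := pi0nu; exists k => // A mA; rewrite kE// nuE.
Qed.
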